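(* For every topological space $X$, $$\mathsf G_1(\Omega_X,\Omega_X)\leq^+_{\mathrm{II}}\mathsf G_1(\mathcal O_X,\mathcal O_X).$$
   Context: No separation axioms are assumed. For a space $X$: $\mathcal O_X$ is the set of all open covers of $X$; $\Omega_X$ is the set of all $\omega$-covers, i.e. open covers $\mathscr U$ such that every finite subset of $X$ is contained in a member of $\mathscr U$. For sets $\mathcal A,\mathcal B$, the game $\mathsf G_1(\mathcal A,\mathcal B)$ has length $\omega$: in round $n\in\omega$, P1 plays $A_n\in\mathcal A$ and P2 responds with $x_n\in A_n$. P2 wins if $\{x_n:n\in\omega\}\in\mathcal B$; otherwise P1 wins. For such a game $\mathcal G=\mathsf G_1(\mathcal A,\mathcal B)$: - $\mathrm{II}\uparrow\mathcal G$: P2 has a winning strategy (a function assigning to each non-empty finite sequence $\langle A_0,\dots,A_n\rangle$ in $\mathcal A$ an element of $A_n$, which wins every run). - $\mathrm{II}\underset{\mathrm{mark}}{\uparrow}\mathcal G$: P2 has a winning Markov strategy, i.e. a winning strategy depending only on P1's most recent move and the round number (a function $\sigma$ on $\mathcal A\times\omega$ with $\sigma(A,n)\in A$). - $\mathrm I\uparrow\mathcal G$: P1 has a winning strategy (a function from finite sequences of moves of P2 to $\mathcal A$, which wins every run). - $\mathrm I\underset{\mathrm{pre}}{\uparrow}\mathcal G$: P1 has a winning predetermined strategy, i.e. one depending only on the round number (a function $\omega\to\mathcal A$). - $\mathrm I\underset{\mathrm{cnst}}{\uparrow}\mathcal G$: there is a single $A_0\in\mathcal A$ such that playing $A_0$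 in every round is a winning strategy for P1. A negated arrow denotes the negation of the corresponding statement. For games $\mathcal G,\mathcal H$, $\mathcal G\leq^+_{\mathrm{II}}\mathcal H$ means that all of the following hold: (i) $\mathrm{II}\underset{\mathrm{mark}}{\uparrow}\mathcal G\Rightarrow\mathrm{II}\underset{\mathrm{mark}}{\uparrow}\mathcal H$; (ii) $\mathrm{II}\uparrow\mathcal G\Rightarrow\mathrm{II}\uparrow\mathcal H$; (iii) $\mathrm I\not\uparrow\mathcal G\Rightarrow\mathrm I\not\uparrow\mathcal H$; (iv) $\mathrm I\underset{\mathrm{pre}}{\not\uparrow}\mathcal G\Rightarrow\mathrm I\underset{\mathrm{pre}}{\not\uparrow}\mathcal H$; (v) $\mathrm I\underset{\mathrm{cnst}}{\not\uparrow}\mathcal G\Rightarrow\mathrm I\underset{\mathrm{cnst}}{\not\uparrow}\mathcal H$.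
   Formalization: Open covers (and hence ω-covers) are required to be non-empty families; this matters only for the empty space, where the empty family would be an open cover to which P2 has no legal response and the claim would fail. *)

(* Defs.v *)
From mathcomp Require Import all_boot all_order.
From mathcomp Require Import all_classical topology.

Set Implicit Arguments.
Unset Strict Implicit.
Unset Printing Implicit Defensive.

Local Open Scope classical_set_scope.

(* The requirement [U !=set0] follows from the other two as soon as X is
   nonempty (see [open_coversE]).  Its only effect is to exclude the empty
   family as a cover of the empty space: P2 has no legal answer to it. *)
Definition open_covers (X : topologicalType) : set (set (set X)) :=
  [set U | [/\ U !=set0, U `<=` open & \bigcup_(V in U) V = [set: X]]].

Definition omega_covers (X : topologicalType) : set (set (set X)) :=
  [set U | open_covers U /\
     forall F : set X, finite_set F -> exists2 V, U V & F `<=` V].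

Lemma open_coversE (X : topologicalType) (U : set (set X)) :
  [set: X] !=set0 ->
  open_covers U <-> U `<=` open /\ \bigcup_(V in U) V = [set: X].
Proof.
move=> [x _]; split=> [[_ oU cU]|[oU cU]]; first by split.
split=> //; have : (\bigcup_(V in U) V) x by rewrite cU.
by case=> V UV _; exists V.
Qed.

(* [G1 A B] is the game in which P1 plays [A_n] in [A], P2 answers with
   [x_n] in [A_n], and P2 wins iff [{x_n : n}] is in [B]. *)
Record selection_game (T : Type) := G1 {
  p1_moves : set (set T);
  p2_goal : set (set T) }.

Section Strategies.
Context {T : Type} (G : selection_game T).

Local Notation A := (p1_moves G).
Local Notation B := (p2_goal G).

(* Strategies are total functions; only their values on sequences of legal
   moves of the opponent matter.  In round n, P2 has seen
   [mkseq a n.+1 = [:: a 0; ...; a n]], whereas P1 has seen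
   [mkseq x n = [:: x 0; ...; x n.-1]]. *)
Definition II_winning (sigma : seq (set T) -> T) : Prop :=
  (forall (s : seq (set T)) (a : set T),
     (forall i, (i < size s)%N -> A (nth set0 s i)) -> A a ->
     a (sigma (rcons s a))) /\
  (forall a : nat -> set T, (forall n, A (a n)) ->
     B (range (fun n => sigma (mkseq a n.+1)))).

Definition II_wins : Prop := exists sigma, II_winning sigma.

Definition II_mark_wins : Prop :=
  exists sigma : set T -> nat -> T,
    (forall a n, A a -> a (sigma a n)) /\
    (forall a : nat -> set T, (forall n, A (a n)) ->
       B (range (fun n => sigma (a n) n))).

Definition I_winning (tau : seq T -> set T) : Prop :=
  (forall s, A (tau s)) /\
  (forall x : nat -> T, (forall n, tau (mkseq x n) (x n)) -> ~ B (range x)).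

Definition I_wins : Prop := exists tau, I_winning tau.

Definition I_pre_wins : Prop :=
  exists a : nat -> set T, I_winning (fun s => a (size s)).

Definition I_cnst_wins : Prop :=
  exists2 a : set T, A a & I_winning (fun=> a).

End Strategies.

Definition le_II_plus (T T' : Type)
    (G : selection_game T) (H : selection_game T') : Prop :=
  [/\ II_mark_wins G -> II_mark_wins H,
      II_wins G -> II_wins H,
      ~ I_wins G -> ~ I_wins H,
      ~ I_pre_wins G -> ~ I_pre_wins H &
      ~ I_cnst_wins G -> ~ I_cnst_wins H].

(* Main.v *)
(* Player I: a winning strategy in the game on open covers gives one in the
   game on omega-covers, where the cover offered at a position consists of the
   unions of the finite nonempty legal continuations of that position; any
   finite set of points is covered by such a union.  P1 decodes the answers
   into blocks and concatenates them.  A predetermined strategy [a] is instead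
   split along a bijection [nat * nat -> nat], the n-th omega-cover being made
   of the unions of initial selections from the n-th subsequence of [a].

   Player II: at each position a strategy of P2 in the game on omega-covers
   determines a finite set all of whose open supersets are possible answers.
   In the game on open covers P2 covers the points of that set one at a time,
   then advances the simulated game by the union of the answers.  For Markov
   strategies the finite sets depend on the round only, so all their points can
   be enumerated in advance. *)
Require Import Defs.
From mathcomp Require Import all_boot all_order.
From mathcomp Require Import all_classical topology.

Set Implicit Arguments.
Unset Strict Implicit.
Unset Printing Implicit Defensive.

Local Open Scope classical_set_scope.

(** * Histories of a player's own replies *)

Section Replies.
Context {S T : Type}.
Implicit Type f : seq S -> T -> S.

(** Lets a strategy be specified by its own earlier replies and the current move: the history is
    rebuilt from the opponent's moves alone. *)
Definition replies f (w : seq T) : seq S :=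
  foldl (fun s x => rcons s (f s x)) [::] w.

Lemma replies_rcons f w x :
  replies f (rcons w x) = rcons (replies f w) (f (replies f w) x).
Proof. by rewrite /replies -cats1 foldl_cat. Qed.

Lemma replies_mkseq f (w : nat -> T) n :
  replies f (mkseq w n) = mkseq (fun m => f (replies f (mkseq w m)) (w m)) n.
Proof. elim: n => // n IHn.
by rewrite [in LHS]mkseqS replies_rcons {1}IHn -mkseqS. Qed.

End Replies.

(** * Infinite concatenation of nonempty finite blocks *)

Section Concatenation.
Context {T : eqType} (x0 : T) (b : nat -> seq T).
Hypothesis b_gt0 : forall n, (0 < size (b n))%N.

Lemma flatten_mkseqS n :
  flatten (mkseq b n.+1) = flatten (mkseq b n) ++ b n.
Proof. by rewrite mkseqS flatten_rcons. Qed.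

Lemma leq_size_flatten n : (n <= size (flatten (mkseq b n)))%N.
Proof.
elim: n => // n IHn; rewrite flatten_mkseqS size_cat.
by rewrite -addn1 leq_add.
Qed.

Lemma nth_flatten_mkseq m n i : (i < size (flatten (mkseq b m)))%N ->
  (m <= n)%N -> nth x0 (flatten (mkseq b n)) i = nth x0 (flatten (mkseq b m)) i.
Proof.
move=> im /subnKC <-; elim: (n - m)%N => [|k IHk]; first by rewrite addn0.
suff ik : (i < size (flatten (mkseq b (m + k))))%N.
  by rewrite addnS flatten_mkseqS nth_cat ik.
elim: k {IHk} => [|k IHk]; first by rewrite addn0.
by rewrite addnS flatten_mkseqS size_cat ltn_addr.
Qed.

(** As blocks are nonempty, entry [i] is settled after [i.+1] blocks, so the finite concatenations
    are initial segments of one infinite sequence. *)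
Lemma flatten_mkseqE n :
  flatten (mkseq b n) =
  mkseq (fun i => nth x0 (flatten (mkseq b i.+1)) i) (size (flatten (mkseq b n))).
Proof.
apply: (@eq_from_nth _ x0) => [|i il]; first by rewrite size_mkseq.
rewrite nth_mkseq //; have [ni|ni] := leqP n i.+1.
  by rewrite (nth_flatten_mkseq (m := n)).
by rewrite -(nth_flatten_mkseq (n := n)) // ?leq_size_flatten // ltnW.
Qed.

End Concatenation.

Lemma nat_pairing : exists (enc : nat * nat -> nat) (dec : nat -> nat * nat),
  cancel enc dec /\ cancel dec enc.
Proof.
have /card_set_bijP[f [_ finj fsurj]] := card_nat2.
have /choice[g gK] : forall n, exists p, f p = n.
  by move=> n; have [p _ <-] := fsurj n I; exists p.
by exists f, g; split=> // p; apply: finj; rewrite ?inE.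
Qed.

(** * Basic facts on open covers and omega-covers *)

Section Covers.
Context {X : topologicalType}.
Implicit Types (U V : set X) (A : set (set X)).

Lemma omega_coversI A : A `<=` open ->
  (forall F : set X, finite_set F -> exists2 V, A V & F `<=` V) ->
  omega_covers A.
Proof.
move=> oA fA; split=> //; split=> //.
  by have [V AV _] := fA set0 (finite_set0 _); exists V.
apply/seteqP; split=> // x _.
by have [V AV xV] := fA [set x] (finite_set1 _); exists V => //; exact: xV.
Qed.

Lemma open_covers_range (U : nat -> set X) : (forall n, open (U n)) ->
  (forall x, exists n, U n x) -> open_covers (range U).
Proof.
move=> oU cU; split; first by exists (U 0%N), 0%N.
  by move=> _ [n _ <-].
apply/seteqP; split=> // x _; have [n Unx] := cU x.
by exists (U n) => //; exists n.
Qed.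

Lemma open_covers_open A U : open_covers A -> A U -> open U.
Proof. by case=> _ oA _; exact: oA. Qed.

Lemma open_covers_cover A x : open_covers A -> exists2 U, A U & U x.
Proof.
case=> _ _ cA; have : [set: X] x by [].
by rewrite -cA => -[U]; exists U.
Qed.

Lemma range_cover (U : nat -> set X) x :
  open_covers (range U) -> exists n, U n x.
Proof. by move=> /(open_covers_cover x)[_ [n _ <-]]; exists n. Qed.

End Covers.

(** * Strategies of the second player *)

Section PlayerII.
Context {X : topologicalType}.

(* Galvin's trick: otherwise the open sets which are not values of [f] would
   form an omega-cover, whose image under [f] would be such a value. *)
Lemma galvin (f : set (set X) -> set X) :
  (forall A, omega_covers A -> A (f A)) ->
  exists s : seq X, forall U, open U -> [set` s] `<=` U ->
    exists2 A, omega_covers A & f A = U.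
Proof.
move=> fA; apply: contrapT => /forallNP nos.
pose A := [set U | open U /\ forall B, omega_covers B -> f B <> U].
have oA : omega_covers A.
  apply: omega_coversI => [U []//|F /finite_seqP[s ->]].
  have /existsNP[U /not_implyP[oU /not_implyP[sU nU]]] := nos s.
  by exists U => //; split=> // B oB fB; apply: nU; exists B.
by have [_ /(_ A oA)] := fA A oA.
Qed.

(** Here [phi] is a winning strategy for the first player of the finite-open game. Each open [V n]
    containing the prescribed finite set is the answer of [sigma] to some omega-cover [A n], so the
    [V n] are the answers in a legal run of [sigma]. *)
Lemma finite_open_strategy (sigma : seq (set (set X)) -> set X) :
  II_winning (G1 (@omega_covers X) (@omega_covers X)) sigma ->
  exists phi : seq (set X) -> seq X, forall V : nat -> set X,
    (forall n, open (V n)) ->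
    (forall n, [set` phi (mkseq V n)] `<=` V n) ->
    forall x, exists n, V n x.
Proof.
case=> /= legal_sigma win_sigma.
pose legal s := forall i, (i < size s)%N ->
  omega_covers (nth (set0 : set (set X)) s i).
have /choice[F FP] : forall s, exists t : seq X, legal s ->
    forall U, open U -> [set` t] `<=` U ->
    exists2 A, omega_covers A & sigma (rcons s A) = U.
  move=> s; have [ls|nls] := pselect (legal s); last by exists [::].
  have [t tP] := galvin (fun A => @legal_sigma s A ls).
  by exists t.
pose f s U := xget set0 [set A | omega_covers A /\ sigma (rcons s A) = U].
exists (F \o replies f) => V oV sV.
pose A n := f (replies f (mkseq V n)) (V n).
have repliesE n : replies f (mkseq V n) = mkseq A n by rewrite replies_mkseq.
have stepA n : legal (mkseq A n) ->
    omega_covers (A n) /\ sigma (mkseq A n.+1) = V n.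
  move=> lA; rewrite mkseqS {1 3}/A repliesE.
  apply: (@xgetPex _ set0 [set B | omega_covers B /\ sigma (rcons _ B) = V n]).
  have sVn := sV n; rewrite /= repliesE in sVn.
  by have [B oB sB] := FP _ lA _ (oV n) sVn; exists B.
have legalA n : legal (mkseq A n).
  elim: n => [//|n IHn] i; rewrite size_mkseq => ilt; rewrite nth_mkseq //.
  move: ilt; rewrite ltnS leq_eqVlt => /predU1P[->|ilt].
    by have [] := stepA n IHn.
  by rewrite -(nth_mkseq set0 A ilt); apply: IHn; rewrite size_mkseq.
have [cV _] := win_sigma A (fun n => (stepA n (legalA n)).1).
move=> x; have [n] := range_cover x cV.
by rewrite (stepA n (legalA n)).2; exists n.
Qed.

Definition block_union (s : seq (set X)) : set X := \bigcup_(U in [set` s]) U.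

(* The first component lists the unions of the completed blocks, the second
   one the answers received in the current block.  A block has one answer for
   each point of [phi] and a spare one, so that blocks are nonempty. *)
Definition parse_step (phi : seq (set X) -> seq X)
    (st : seq (set X) * seq (set X)) (U : set X) :=
  if (size st.2 < size (phi st.1))%N then (st.1, rcons st.2 U)
  else (rcons st.1 (block_union (rcons st.2 U)), [::]).

Definition parse phi (w : seq (set X)) := foldl (parse_step phi) ([::], [::]) w.

Lemma parse_rcons phi w U :
  parse phi (rcons w U) = parse_step phi (parse phi w) U.
Proof. by rewrite /parse -cats1 foldl_cat. Qed.

Lemma parse_block phi (U : nat -> set X) W m j : (j <= size (phi W))%N ->
  parse phi (mkseq U m) = (W, [::]) ->
  parse phi (mkseq U (m + j)) = (W, mkseq (fun i => U (m + i)%N) j).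
Proof.
move=> jW parseW; elim: j jW => [|j IHj] jW; first by rewrite addn0.
rewrite addnS mkseqS parse_rcons IHj ?(ltnW jW)//.
by rewrite /parse_step size_mkseq jW -mkseqS.
Qed.

Lemma parse_next phi (U : nat -> set X) W m :
  parse phi (mkseq U m) = (W, [::]) ->
  parse phi (mkseq U (m + size (phi W)).+1) =
    (rcons W (block_union (mkseq (fun i => U (m + i)%N) (size (phi W)).+1)), [::]).
Proof.
move=> parseW; rewrite mkseqS parse_rcons (parse_block _ parseW) //.
by rewrite /parse_step size_mkseq ltnn -mkseqS.
Qed.

(** Passes from the finite-open game to the point-open game: the points of each finite set are
    played in successive rounds. *)
Lemma point_open_strategy (x0 : X) (phi : seq (set X) -> seq X) :
  (forall V : nat -> set X, (forall n, open (V n)) ->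
    (forall n, [set` phi (mkseq V n)] `<=` V n) -> forall x, exists n, V n x) ->
  exists rho : seq (set X) -> X, forall U : nat -> set X,
    (forall n, open (U n)) -> (forall n, U n (rho (mkseq U n))) ->
    forall x, exists n, U n x.
Proof.
move=> winphi.
(* The default [x0] is the point played in the spare round that closes each block. *)
exists (fun w => nth x0 (phi (parse phi w).1) (size (parse phi w).2)) => U oU rhoU.
(* [t n] is the round in which the n-th block starts. *)
pose next m := (m + size (phi (parse phi (mkseq U m)).1)).+1.
pose t n := iter n next 0%N.
pose block n :=
  mkseq (fun i => U (t n + i)%N) (size (phi (parse phi (mkseq U (t n))).1)).+1.
pose V n := block_union (block n).
have parseV n : parse phi (mkseq U (t n)) = (mkseq V n, [::]).
  elim: n => // n IHn; have -> : t n.+1 = next (t n) by [].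
  by rewrite /next IHn (parse_next IHn) [mkseq V n.+1]mkseqS [V n]/V /block IHn.
have oV n : open (V n).
  by apply: bigcup_open => W /= /mapP[i _ ->].
have phiV n : [set` phi (mkseq V n)] `<=` V n.
  move=> x /= xphi; pose i := index x (phi (mkseq V n)).
  have ilt : (i < size (phi (mkseq V n)))%N by rewrite index_mem.
  exists (U (t n + i)%N).
    by rewrite /= /block parseV; apply: map_f; rewrite mem_iota /= ltnS ltnW.
  have := rhoU (t n + i)%N.
  by rewrite (parse_block (ltnW ilt) (parseV n)) /= size_mkseq nth_index.
move=> x; have [n [W /= /mapP[i _ ->]]] := winphi V oV phiV x.
by exists (t n + i)%N.
Qed.

Lemma II_mark_wins_II_wins (T : Type) (G : selection_game T) :
  II_mark_wins G -> II_wins G.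
Proof.
move=> [sigma [legal_sigma win_sigma]].
exists (fun s => sigma (last set0 s) (size s).-1); split=> [s a _ Aa|a Aa].
  by rewrite last_rcons; exact: legal_sigma.
have -> : (fun n => sigma (last set0 (mkseq a n.+1)) (size (mkseq a n.+1)).-1)
          = (fun n => sigma (a n) n).
  by apply/funext => n; rewrite size_mkseq mkseqS last_rcons.
exact: win_sigma.
Qed.

(** Every nonempty family of open sets covers the empty space, so any legal choice wins. *)
Lemma II_mark_wins_empty : [set: X] = set0 ->
  II_mark_wins (G1 (@open_covers X) (@open_covers X)).
Proof.
move=> X0; exists (fun A _ => xget set0 A); split=> [A _ [[U AU] _ _]|A oA] /=.
  by apply: xgetPex; exists U.
apply: open_covers_range => [n|x].
  apply: (open_covers_open (oA n)); apply: xgetPex.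
  by have [[U AU] _ _] := oA n; exists U.
by have : [set: X] x by []; rewrite X0.
Qed.

Lemma II_wins_open_covers :
  II_wins (G1 (@omega_covers X) (@omega_covers X)) ->
  II_wins (G1 (@open_covers X) (@open_covers X)).
Proof.
move=> [sigma sigmaP]; have [X0|/set0P[x0 _]] := eqVneq [set: X] set0.
  exact/II_mark_wins_II_wins/II_mark_wins_empty.
have [phi phiP] := finite_open_strategy sigmaP.
have [rho rhoP] := point_open_strategy x0 phiP.
(* P2 chooses a member containing the point that [rho] prescribes after P2's own earlier choices
   [r]. *)
pose pick r (A : set (set X)) := xget set0 [set U | A U /\ U (rho r)].
have pickP r A : open_covers A -> A (pick r A) /\ pick r A (rho r).
  move=> oA; apply: (@xgetPex _ set0 [set U | A U /\ U (rho r)]).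
  by have [U AU Ux] := open_covers_cover (rho r) oA; exists U.
exists (fun h => last set0 (replies pick h)); split=> /= [s A _ oA|A oA].
  by rewrite replies_rcons last_rcons; have [] := pickP (replies pick s) A oA.
pose U n := pick (replies pick (mkseq A n)) (A n).
have -> : (fun n => last set0 (replies pick (mkseq A n.+1))) = U.
  by apply/funext => n; rewrite mkseqS replies_rcons last_rcons.
have oU n : open (U n).
  apply: (open_covers_open (oA n)).
  by have [] := pickP (replies pick (mkseq A n)) _ (oA n).
apply: open_covers_range => //; apply: rhoP => // n.
have <- : replies pick (mkseq A n) = mkseq U n by rewrite replies_mkseq.
by have [] := pickP (replies pick (mkseq A n)) _ (oA n).
Qed.

Lemma II_mark_wins_open_covers :
  II_mark_wins (G1 (@omega_covers X) (@omega_covers X)) ->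
  II_mark_wins (G1 (@open_covers X) (@open_covers X)).
Proof.
move=> [sigma [/= legal_sigma win_sigma]].
have [X0|/set0P[x0 _]] := eqVneq [set: X] set0; first exact: II_mark_wins_empty.
have [F FP] := choice (fun n => galvin (fun A => @legal_sigma A n)).
have [enc [dec [encK _]]] := nat_pairing.
(* Round [enc (n, i)] is devoted to the i-th point of [F n], or to [x0] past its end. *)
pose pt m := nth x0 (F (dec m).1) (dec m).2.
pose pick (A : set (set X)) m := xget set0 [set U | A U /\ U (pt m)].
have pickP A m : open_covers A -> A (pick A m) /\ pick A m (pt m).
  move=> oA; apply: (@xgetPex _ set0 [set U | A U /\ U (pt m)]).
  by have [U AU Ux] := open_covers_cover (pt m) oA; exists U.
exists pick; split=> /= [A m oA|A oA]; first by have [] := pickP A m oA.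
have oU m : open (pick (A m) m).
  by apply: (open_covers_open (oA m)); have [] := pickP (A m) m (oA m).
apply: open_covers_range => // x.
(* An open superset of [F n], hence an answer of [sigma] in round [n] to some omega-cover. *)
pose V n := \bigcup_i pick (A (enc (n, i))) (enc (n, i)).
have /choice[B BP] : forall n, exists B, omega_covers B /\ sigma B n = V n.
  move=> n; have oV : open (V n) by apply: bigcup_open => i _.
  have FV : [set` F n] `<=` V n.
    move=> y /= yF; exists (index y (F n)) => //.
    have [_] := pickP _ (enc (n, index y (F n))) (oA (enc (n, index y (F n)))).
    by rewrite {1}/pt encK /= nth_index.
  by have [B oB sB] := FP n _ oV FV; exists B.
have [cV _] := win_sigma B (fun n => (BP n).1).
have [n] := range_cover x cV; rewrite (BP n).2 => -[i _ ?].
by exists (enc (n, i)).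
Qed.

End PlayerII.

(** * Strategies of the first player *)

Section PlayerI.
Context {X : topologicalType}.

Section Unions.
Variable tau : seq (set X) -> set (set X).
Hypothesis tau_cover : forall s, open_covers (tau s).

Definition legal (r b : seq (set X)) :=
  forall i, (i < size b)%N -> tau (r ++ take i b) (nth set0 b i).

Lemma legal_cat r b c : legal r b -> legal (r ++ b) c -> legal r (b ++ c).
Proof.
move=> lb lc i; rewrite size_cat nth_cat take_cat.
have [ib _|bi ilt] := ltnP i (size b); first exact: lb.
by rewrite catA; apply: lc; rewrite ltn_subLR.
Qed.

Definition legal_unions (r : seq (set X)) : set (set X) :=
  [set W | exists b, [/\ (0 < size b)%N, legal r b & W = block_union b]].

Lemma legal1 r U : tau r U -> legal r [:: U].
Proof. by move=> rU [|//] _; rewrite take0 cats0. Qed.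

Lemma legal_open r b U : legal r b -> U \in b -> open U.
Proof.
move=> lb Ub; apply: (open_covers_open (tau_cover (r ++ take (index U b) b))).
by rewrite -[X in tau _ X](nth_index set0 Ub); apply: lb; rewrite index_mem.
Qed.

(** The points of a finite set are covered one at a time, each by an answer to [tau] at the current
    position; a last arbitrary answer keeps the block nonempty. *)
Lemma legal_unions_omega r : omega_covers (legal_unions r).
Proof.
apply: omega_coversI => [_ [b [_ lb ->]]|F /finite_seqP[s ->]].
  by apply: bigcup_open => U; exact: legal_open lb.
suff [b [b0 lb sb]] : exists b,
    [/\ (0 < size b)%N, legal r b & [set` s] `<=` block_union b].
  by exists (block_union b) => //; exists b.
elim: s r => [|x s IHs] r.
  have [[U rU] _ _] := tau_cover r.
  by exists [:: U]; split=> //; exact: legal1.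
have [U rU Ux] := open_covers_cover x (tau_cover r).
have [b [b0 lb sb]] := IHs (rcons r U).
exists (U :: b); split=> //.
  by rewrite -cat1s; apply: legal_cat (legal1 rU) _; rewrite cats1.
move=> y /=; rewrite inE => /predU1P[->|/sb[V /= Vb Vy]].
  by exists U => //=; rewrite mem_head.
by exists V => //=; rewrite inE Vb orbT.
Qed.

End Unions.

Lemma I_wins_omega_covers :
  I_wins (G1 (@open_covers X) (@open_covers X)) ->
  I_wins (G1 (@omega_covers X) (@omega_covers X)).
Proof.
move=> [tau [/= tau_cover win_tau]].
pose g bs W := xget [::] [set b | [/\ (0 < size b)%N,
  legal tau (flatten bs) b & W = block_union b]].
exists (fun w => legal_unions tau (flatten (replies g w))).
split=> /= [s|W legalW [cW _]]; first exact: legal_unions_omega.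
pose b n := g (replies g (mkseq W n)) (W n).
have repliesE n : replies g (mkseq W n) = mkseq b n by rewrite replies_mkseq.
have bP n : [/\ (0 < size (b n))%N,
    legal tau (flatten (mkseq b n)) (b n) & W n = block_union (b n)].
  rewrite -repliesE; exact: (xgetPex [::] (legalW n)).
have b0 n : (0 < size (b n))%N by have [] := bP n.
(* The single run against [tau] formed by the decoded blocks. *)
pose x i := nth set0 (flatten (mkseq b i.+1)) i.
have legalb n : legal tau [::] (flatten (mkseq b n)).
  elim: n => // n IHn; rewrite flatten_mkseqS; apply: legal_cat => //.
  by have [] := bP n.
have legalx n : tau (mkseq x n) (x n).
  have nlt := leq_size_flatten b0 n.+1.
  have := legalb n.+1 n nlt.
  rewrite (flatten_mkseqE set0 b0 n.+1) nth_mkseq //.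
  by rewrite /= /mkseq -map_take take_iota (minn_idPl (ltnW nlt)).
apply: (win_tau x legalx); apply: open_covers_range => [n|y].
  exact: open_covers_open (tau_cover _) (legalx n).
have [n] := range_cover y cW; have [_ _ ->] := bP n => -[U /= Ub Uy].
have : U \in flatten (mkseq b n.+1) by rewrite flatten_mkseqS mem_cat Ub orbT.
rewrite (flatten_mkseqE set0 b0) => /mapP[i _ Ui].
by exists i; rewrite /x -Ui.
Qed.

(** The selection [u] is total, although only [k] values are united, so that every round of the
    interleaved run gets a legal answer. *)
Definition initial_unions (c : nat -> set (set X)) : set (set X) :=
  [set W | exists (u : nat -> set X) k, (forall i, c i (u i)) /\
     W = \bigcup_(i < k) u i].

Lemma initial_unions_omega c : (forall i, open_covers (c i)) ->
  omega_covers (initial_unions c).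
Proof.
move=> oc; apply: omega_coversI => [_ [u [k [cu ->]]]|F /finite_seqP[s ->]].
  by apply: bigcup_open => i _; exact: open_covers_open (oc i) (cu i).
have /choice[u uP] : forall i, exists U, c i U /\
    forall x, onth s i = Some x -> U x.
  move=> i; case: (onth s i) => [x|].
    have [U cU Ux] := open_covers_cover x (oc i).
    by exists U; split=> // _ [<-].
  by have [[U cU] _ _] := oc i; exists U.
exists (\bigcup_(i < size s) u i).
  by exists u, (size s); split=> // i; have [] := uP i.
move=> x /= /onthP[i si]; exists i; last by have [_ /(_ x si)] := uP i.
by rewrite /= -onthTE si.
Qed.

(** The selections behind the [W n] interleave along [enc] into one run against [a], whose answers
    cover every point of every [W n]. *)
Lemma initial_unions_win (a : nat -> set (set X)) (enc : nat * nat -> nat)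
    (dec : nat -> nat * nat) : cancel enc dec -> cancel dec enc ->
  (forall n, open_covers (a n)) ->
  (forall x : nat -> set X, (forall n, a n (x n)) -> ~ open_covers (range x)) ->
  forall W : nat -> set X,
    (forall n, initial_unions (fun i => a (enc (n, i))) (W n)) ->
    ~ omega_covers (range W).
Proof.
move=> encK decK oa win_a W legalW [cW _].
have [u uP] := choice legalW.
pose x m := u (dec m).1 (dec m).2.
have ax m : a m (x m).
  by have [k [/(_ (dec m).2)]] := uP (dec m).1; rewrite -surjective_pairing decK.
apply: (win_a x ax); apply: open_covers_range => [m|y].
  exact: open_covers_open (oa m) (ax m).
have [n] := range_cover y cW; have [k [_ ->]] := uP n => -[i _ uy].
by exists (enc (n, i)); rewrite /x encK.
Qed.

Lemma I_pre_wins_omega_covers :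
  I_pre_wins (G1 (@open_covers X) (@open_covers X)) ->
  I_pre_wins (G1 (@omega_covers X) (@omega_covers X)).
Proof.
move=> [a [/= a_cover win_a]].
have [enc [dec [encK decK]]] := nat_pairing.
(* Any history of length [n] makes the strategy play [a n]. *)
have oa n : open_covers (a n) by rewrite -(size_nseq n (set0 : set X)).
exists (fun n => initial_unions (fun i => a (enc (n, i)))).
split=> /= [s|W legalW]; first exact: initial_unions_omega.
apply: (initial_unions_win encK decK oa) => [x ax|n].
  by apply: win_a => n; rewrite size_mkseq.
by have := legalW n; rewrite size_mkseq.
Qed.

Lemma I_cnst_wins_omega_covers :
  I_cnst_wins (G1 (@open_covers X) (@open_covers X)) ->
  I_cnst_wins (G1 (@omega_covers X) (@omega_covers X)).
Proof.
move=> [a /= oa [/= _ win_a]].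
have [enc [dec [encK decK]]] := nat_pairing.
have oU : omega_covers (initial_unions (fun=> a)).
  by apply: initial_unions_omega.
exists (initial_unions (fun=> a)) => //; split=> //= W legalW.
exact: (@initial_unions_win (fun=> a) _ _ encK decK).
Qed.

End PlayerI.

Theorem theorem4p44 (X : topologicalType) :
  le_II_plus (G1 (@omega_covers X) (@omega_covers X))
             (G1 (@open_covers X) (@open_covers X)).
Proof.
split.
- exact: II_mark_wins_open_covers.
- exact: II_wins_open_covers.
- exact/contra_not/I_wins_omega_covers.
- exact/contra_not/I_pre_wins_omega_covers.
- exact/contra_not/I_cnst_wins_omega_covers.
Qed.
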